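(* For all integers $g\ge1$ and $n\ge1$, $H^\sim_{g,n}=H_{g,n}$.
   Context: Complex origami counts. - For $\lambda\vdash n$ let $C_\lambda\subset S_n$ be the conjugacy class of cycle type $\lambda$. - Let $h^\circ_{\lambda,n}=\frac{1}{n!}\#\{(\sigma,\rho)\in S_n\times S_n:\sigma\rho\sigma^{-1}\rho^{-1}\in C_\lambda\}$. - Define $h_{\lambda,n}$ as the coefficients of the logarithm $$\log\Bigl(\sum_{n\ge0}\sum_{\lambda\vdash n}h^\circ_{\lambda,n}p_\lambda t^n\Bigr)=\sum_{n\ge1}\sum_{\lambda\vdash n}h_{\lambda,n}p_\lambda t^n,$$ where $p_\lambda=\prod_i p_{\lambda_i}$ are products of formal power-sum variables. - Put $H_{g,n}=\sum_{\lambda\vdash n,\ \ell(\lambda)=n+2-2g}h_{\lambda,n}$, where $\ell(\lambda)$ is the number of parts of $\lambda$. This is the weighted number of connected origami of degree $n$ and genus $g$. Monotone double Hurwitz numbers. - A sequence of transpositions $\tau_i=(a_i,b_i)$ with $a_i<b_i$ is strictly monotone if $b_i<b_{i+1}$ for all $i$. - Define $$H^\sim_{g,n}=\frac{1}{n!}\#\{(\sigma,\rho,\tau_1,\dots,\tau_{2g-2})\},$$ counting tuples such that: $\sigma,\rho\in S_n$; each $\tau_i\in S_n$ is a transposition; $(\tau_1,\dots,\tau_{2g-2})$ is strictly monotone; $\sigma\rho\sigma^{-1}\rho^{-1}\tau_1\cdots\tau_{2g-2}=\mathrm{id}$; and the group $\langle\tau_1,\dots,\tau_{2g-2},\sigma,\rho\rangle$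 acts transitively on $\{1,\dots,n\}$. *)

(* Defs.v *)
From HB Require Import structures.
From mathcomp Require Import all_boot all_order all_algebra all_fingroup.
From mathcomp Require Import mpoly.
Set Implicit Arguments. Unset Strict Implicit. Unset Printing Implicit Defensive.
Import GRing.Theory.
Local Open Scope ring_scope.

(* We work in {mpoly rat[N]}, variable 'X_i (i : 'I_N) standing for the
   power sum p_(i+1).  A partition lambda with parts <= N is encoded by the
   monomial m : 'X_{1..N} with m i = number of parts of lambda equal to i+1,
   so that 'X_[m] = p_lambda.                                                *)

Definition pweight N (m : 'X_{1..N}) : nat := (\sum_(i < N) i.+1 * m i)%N.
(* l(lambda) : the number of parts is the total degree mdeg m *)

Definition cyctype N k (s : 'S_k) : 'X_{1..N} :=
  [multinom #|[set X in porbits s | #|X| == i.+1]| | i < N].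

Definition commut k (sr : 'S_k * 'S_k) : 'S_k :=
  (sr.1 * sr.2 * sr.1^-1 * sr.2^-1)%g.

Definition hcirc N (m : 'X_{1..N}) (k : nat) : rat :=
  (#|[set sr : 'S_k * 'S_k | cyctype N (commut sr) == m]|)%:R / (k`!)%:R.

(* the coefficient of t^k: sum over lambda |- k of h^o_{lambda,k} p_lambda
   (partitions of k have at most k parts, so mdeg m < k.+1) *)
Definition Pcoef N (k : nat) : {mpoly rat[N]} :=
  \sum_(m : 'X_{1..N < k.+1} | pweight m == k) hcirc m k *: 'X_[(m : 'X_{1..N})].

Definition Fser N (n : nat) : {poly {mpoly rat[N]}} :=
  \sum_(k < n.+1) (Pcoef N k)%:P * 'X^k.

(* log F = sum_{j>=1} (-1)^(j+1)/j (F-1)^j ; since F - 1 is divisible by t,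
   terms with j > n and the truncation of F do not affect the coefficient of
   t^n, so this polynomial has the same t^k-coefficients as log F for k <= n *)
Definition Lser N (n : nat) : {poly {mpoly rat[N]}} :=
  \sum_(j < n) (((-1) ^+ j / (j.+1)%:R : rat)%:MP)%:P * (Fser N n - 1) ^+ j.+1.

(* h_{lambda,n} : coefficient of p_lambda t^n in log F (computed with the
   variables p_1 .. p_n, which is all that partitions of n involve) *)
Definition hcoef (n : nat) (m : 'X_{1..n}) : rat := ((Lser n n)`_n)@_m.

Definition Horig (g n : nat) : rat :=
  \sum_(m : 'X_{1..n < n.+1} | (pweight m == n) && (mdeg m + 2 * g == n + 2)%N)
     hcoef m.

Definition is_transp k (t : 'S_k) : bool :=
  [exists a : 'I_k, exists b : 'I_k, (a < b)%N && (t == tperm a b)].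

Definition tbig k (t : 'S_k) : nat := (\max_(x : 'I_k | t x != x) x)%N.

Definition strictly_monotone k (ts : seq 'S_k) : bool :=
  all (@is_transp k) ts && sorted ltn (map (@tbig k) ts).

Definition monotone_tuples (g n : nat) :=
  [set x : 'S_n * 'S_n * (2 * g - 2).-tuple 'S_n |
    let: (s, r, ts) := x in
    [&& strictly_monotone ts,
        (s * r * s^-1 * r^-1 * \prod_(t <- ts) t)%g == 1%g &
        [transitive <<([set s; r] :|: [set t in ts])>>, on [set: 'I_n] | 'P] ]].

Definition Hmono (g n : nat) : rat := (#|monotone_tuples g n|)%:R / (n`!)%:R.

(* Main.v *)
Require Import Defs.
From HB Require Import structures.
From mathcomp Require Import all_boot all_order all_algebra all_fingroup.
From mathcomp Require Import mpoly.
Set Implicit Arguments. Unset Strict Implicit. Unset Printing Implicit Defensive.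
Import GRing.Theory.

(** Every permutation of 'I_k has exactly one strictly monotone factorization
    into transpositions: the last factor must be [tperm (w b) b] with [b] the
    largest point moved by [w], and multiplying it away splits [b] off its
    cycle.  Hence the number of factors is [k] minus the number of cycles, and
    each factor preserves every union of cycles of [w].  So [Hmono g n] counts
    the pairs [(s, r)] generating a transitive group whose commutator has
    [n + 2 - 2 g] cycles.

    On the other side, splitting a pair [(s, r)] along the orbit of a point
    gives F' = C' F, where F and C are the exponential generating functions of
    all pairs and of the transitive pairs.  Hence log F = C, and [Horig g n] is
    the same count. *)

(** * Stable sets and transitivity *)

Section Stable.
Variable T : finType.
Implicit Types (s t : {perm T}) (Y Z : {set T}).

Definition stable s Y := [forall x, (s x \in Y) == (x \in Y)].

Lemma stableP s Y : reflect (forall x, (s x \in Y) = (x \in Y)) (stable s Y).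
Proof. exact: 'forall_eqP. Qed.

Lemma stableM s t Y : stable s Y -> stable t Y -> stable (s * t) Y.
Proof. by move=> /stableP sY /stableP tY; apply/stableP=> x; rewrite permM tY sY. Qed.

Lemma stableV s Y : stable s Y -> stable s^-1 Y.
Proof. by move=> /stableP sY; apply/stableP=> x; rewrite -sY permKV. Qed.

Lemma stableI s Y Z : stable s Y -> stable s Z -> stable s (Y :&: Z).
Proof. by move=> /stableP sY /stableP sZ; apply/stableP=> x; rewrite !inE sY sZ. Qed.

Lemma stableC s Y : stable s Y -> stable s (~: Y).
Proof. by move=> /stableP sY; apply/stableP=> x; rewrite !inE sY. Qed.

Lemma stable_tperm x y Y : (x \in Y) = (y \in Y) -> stable (tperm x y) Y.
Proof. by move=> xy; apply/stableP=> z; case: tpermP => // ->. Qed.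

Lemma stable_astabs s Y : stable s Y = (s \in 'N(Y | 'P)%g).
Proof.
apply/stableP/idP => [sY | /astabsP sY x]; last by rewrite -[RHS]sY.
by apply/astabsP=> x; rewrite /= apermE.
Qed.

(** The permutations preserving [Y] form a group, so it suffices to test generators; conversely the
    orbit of a point is a nonempty stable set. Nonemptiness of [T] supplies that point. *)
Lemma transitive_stableP (A : {set {perm T}}) : 0 < #|T| ->
  reflect (forall Y, {in A, forall a, stable a Y} -> Y != set0 -> Y = setT)
          [transitive <<A>>%g, on [set: T] | 'P]%g.
Proof.
move=> T0; apply: (iffP idP) => [trA Y AY /set0Pn[y yY] | allA].
  have sAN : <<A>>%g \subset 'N(Y | 'P)%g.
    by rewrite gen_subG; apply/subsetP=> a /AY; rewrite stable_astabs.
  apply/setP=> z; rewrite in_setT.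
  have /imsetP[a aA ->] : z \in orbit 'P <<A>>%g y by rewrite (atransP trA) ?inE.
  by rewrite (astabsP (subsetP sAN a aA)).
have /card_gt0P[x _] := T0.
suff orbT : orbit 'P <<A>>%g x = setT by rewrite -orbT; apply: atrans_orbit.
apply: allA; last by apply/set0Pn; exists x; apply: orbit_refl.
move=> a aA; rewrite stable_astabs; apply: (subsetP (acts_orbit _ _ _)) => //.
  exact: subsetT.
exact: mem_gen.
Qed.

End Stable.

(** * Strictly monotone factorizations *)

Section Jucys.
Variable k : nat.
Implicit Types (t w : 'S_k) (ts : seq 'S_k).
Local Notation prodp ts := (\prod_(t <- ts) t)%g.

Lemma is_transpP t :
  reflect (exists a b : 'I_k, a < b /\ t = tperm a b) (is_transp t).
Proof.
apply: (iffP existsP) => [[a /existsP[b /andP[ab /eqP->]]]|[a [b [ab ->]]]].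
  by exists a, b.
by exists a; apply/existsP; exists b; rewrite ab eqxx.
Qed.

Lemma tbig_eq w (b : 'I_k) :
  w b != b -> (forall x : 'I_k, b < x -> w x = x) -> tbig w = b.
Proof.
move=> wb wfix; apply/eqP; rewrite eqn_leq /tbig; apply/andP; split.
  by apply/bigmax_leqP => x wx; rewrite leqNgt; apply: contra_neqN wx => /wfix.
by rewrite (bigmax_sup b).
Qed.

Lemma tbig_tperm (a b : 'I_k) : a < b -> tbig (tperm a b) = b.
Proof.
move=> ab; apply: tbig_eq => [|x bx].
  by rewrite tpermR; apply: contraTneq ab => ->; rewrite ltnn.
rewrite tpermD //; apply: contraTneq bx => <-; rewrite -leqNgt //.
exact: ltnW.
Qed.

Lemma strictly_monotone_rcons ts t :
  strictly_monotone (rcons ts t) =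
  [&& strictly_monotone ts, is_transp t & all (fun u => tbig u < tbig t) ts].
Proof.
have tr : transitive ltn by move=> y x z; apply: ltn_trans.
rewrite /strictly_monotone all_rcons map_rcons !(sorted_pairwise tr).
rewrite pairwise_rcons all_map; set A := all _ _; set B := all _ _.
by set C := pairwise _ _; rewrite -!andbA; do !bool_congr.
Qed.

Lemma prod_fix ts (m : nat) :
  strictly_monotone ts -> all (fun u => tbig u < m) ts ->
  forall x : 'I_k, m <= x -> (prodp ts) x = x.
Proof.
elim/last_ind: ts => [|ts t IHts]; first by rewrite big_nil => *; rewrite perm1.
rewrite strictly_monotone_rcons => /and3P[smts /is_transpP[a [b [ab ->]]] _].
rewrite all_rcons tbig_tperm // => /andP[bm ltm] x mx.
rewrite big_rcons permM IHts // tpermD //; apply/eqP => ax; move: mx; rewrite -ax leqNgt ?bm //.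
by rewrite (ltn_trans ab bm).
Qed.

(** The earlier factors only move points below [b], so they fix [b], and the product, acting from
    left to right, sends [b] to [a]. Thus the last factor can be read off from the product alone. *)
Lemma strictly_monotone_last ts t :
  strictly_monotone (rcons ts t) ->
  exists b : 'I_k, let w := prodp (rcons ts t) in
    [/\ tbig w = b, w b != b, t = tperm (w b) b & (prodp ts) b = b].
Proof.
rewrite strictly_monotone_rcons => /and3P[smts /is_transpP[a [b [ab ->]]]].
rewrite tbig_tperm // => ltb; exists b => /=; rewrite big_rcons /=.
have fixb := prod_fix smts ltb.
have wb : (prodp ts * tperm a b)%g b = a by rewrite permM fixb // tpermR.
have nab : a != b by apply: contraTneq ab => ->; rewrite ltnn.
rewrite wb; split=> //; last exact: fixb.
apply: tbig_eq => [|x bx]; first by rewrite wb.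
rewrite permM fixb ?tpermD //; last exact: ltnW.
- by apply: contraTneq bx => <-; rewrite -leqNgt ltnW.
- by apply: contraTneq bx => <-; rewrite ltnn.
Qed.

Lemma strictly_monotone_rconsW ts t :
  strictly_monotone (rcons ts t) -> strictly_monotone ts.
Proof. by rewrite strictly_monotone_rcons => /and3P[]. Qed.

Lemma strictly_monotone_inj ts1 ts2 :
  strictly_monotone ts1 -> strictly_monotone ts2 ->
  prodp ts1 = prodp ts2 -> ts1 = ts2.
Proof.
elim/last_ind: ts1 ts2 => [|ts1 t1 IH] ts2; case/lastP: ts2 => [|ts2 t2] //.
- move=> _ sm2; rewrite big_nil => e1.
  by have [b []] := strictly_monotone_last sm2; rewrite -e1 perm1 eqxx.
- move=> sm1 _; rewrite [RHS]big_nil => e1.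
  by have [b []] := strictly_monotone_last sm1; rewrite e1 perm1 eqxx.
move=> sm1 sm2 e12.
have [b1 [tb1 _ et1 _]] := strictly_monotone_last sm1.
have [b2 [tb2 _ et2 _]] := strictly_monotone_last sm2.
have eb : b1 = b2 by apply: val_inj; rewrite /= -tb1 -tb2 e12.
have et : t1 = t2 by rewrite et1 et2 e12 eb.
move: e12; rewrite !big_rcons /= et => /mulIg e12.
by rewrite (IH ts2) ?et //; [apply: strictly_monotone_rconsW sm1
  | apply: strictly_monotone_rconsW sm2].
Qed.

(** The fixed point [b] is a cycle by itself, and the transposition merges it into the cycle of [a].
    Inverses are taken because [porbits_mul_tperm] multiplies on the left. *)
Lemma card_porbits_mul_tperm_fix w (a b : 'I_k) :
  w b = b -> a != b -> #|porbits (w * tperm a b)%g|.+1 = #|porbits w|.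
Proof.
move=> wb ab; have := porbits_mul_tperm w^-1 a b; rewrite /=.
have -> : a \notin porbit w^-1 b.
  rewrite porbitV; apply/porbitP => -[i aE]; case/eqP: ab; rewrite aE {aE}.
  by elim: i => [|i IHi]; rewrite ?perm1 // expgSr permM IHi.
have -> : (tperm a b * w^-1 = (w * tperm a b)^-1)%g by rewrite invMg tpermV.
by rewrite !porbitsV ab addn1 addn2 => -[].
Qed.

Lemma card_porbits_strictly_monotone ts :
  strictly_monotone ts -> #|porbits (prodp ts)| + size ts = k.
Proof.
elim/last_ind: ts => [|ts t IH] smts.
  rewrite big_nil addn0 card_imset ?card_ord // => x y /eqP.
  rewrite eq_porbit_mem => /porbitP[i ->].
  by rewrite expg1n perm1.
have [b [_ wb et fb]] := strictly_monotone_last smts.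
rewrite size_rcons -addSnnS -[RHS](IH (strictly_monotone_rconsW smts)).
congr (_ + _); move: wb et; set a := (X in X b) => wb et.
rewrite /a big_rcons /= {1}et; exact: card_porbits_mul_tperm_fix.
Qed.

(** The last factor exchanges [b] and [w b], which lie in one cycle of the product [w], so it
    preserves every set that [w] preserves; cancel it and induct. *)
Lemma strictly_monotone_stable ts Y :
  strictly_monotone ts -> stable (prodp ts) Y -> {in ts, forall t, stable t Y}.
Proof.
elim/last_ind: ts => [|ts t IH] // smts stY u; rewrite mem_rcons inE.
have [b [_ _ et _]] := strictly_monotone_last smts.
have tY : stable t Y by rewrite et; apply: stable_tperm; apply: (stableP _ _ stY).
case/predU1P => [-> // |]; apply: IH; first exact: strictly_monotone_rconsW smts.
suff -> : (prodp ts = prodp (rcons ts t) * t^-1)%g.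
  by apply: stableM => //; apply: stableV.
by rewrite big_rcons mulgK.
Qed.

Lemma strictly_monotone_exists w :
  exists2 ts, strictly_monotone ts & prodp ts = w.
Proof.
(* Induction on a bound [m] for the moved points; keeping every [tbig] below [m] lets a
   transposition with larger point [m] be appended. *)
suff: forall m, m <= k -> forall w, (forall x : 'I_k, m <= x -> w x = x) ->
    exists ts, [/\ strictly_monotone ts, all (fun u => tbig u < m) ts
                 & prodp ts = w].
  case/(_ k (leqnn k) w) => [x|ts [smts _ <-]]; last by exists ts.
  by rewrite leqNgt ltn_ord.
elim=> [|m IH] lemk {}w wfix.
  exists [::]; split=> //; rewrite big_nil.
  by apply/permP=> x; rewrite perm1 wfix.
pose b := Ordinal lemk; have [wb|wb] := eqVneq (w b) b.
  case: (IH (ltnW lemk) w) => [x|ts [smts lts <-]]; last first.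
    by exists ts; split=> //; apply: sub_all lts => u /ltnW.
  by rewrite leq_eqVlt => /predU1P[bx|/wfix//]; have -> : x = b by apply: val_inj.
pose a := w b; have ab : a < b.
  (* If [a] were above [b], it would be fixed, so [w a = a = w b] and injectivity would give
     [a = b]. *)
  rewrite ltn_neqAle wb leqNgt; apply/negP=> /wfix aa.
  by case/eqP: wb; apply: (@perm_inj _ w).
case: (IH (ltnW lemk) (w * tperm a b)%g) => [x|ts [smts lts pts]].
  rewrite leq_eqVlt permM => /predU1P[bx|mx].
    by have -> : x = b; [apply: val_inj | rewrite tpermL].
  rewrite wfix // tpermD //; apply: contraTneq mx => <-; rewrite -leqNgt //.
  exact: ltnW.
exists (rcons ts (tperm a b)); split.
- rewrite strictly_monotone_rcons smts tbig_tperm // lts andbT.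
  by apply/is_transpP; exists a, b.
- rewrite all_rcons tbig_tperm // ltnSn; apply: sub_all lts => u.
  exact: leqW.
- by rewrite big_rcons /= pts -mulgA tperm2 mulg1.
Qed.

End Jucys.

(** * Splitting a pair along its components *)

Section Components.
Variable T : finType.
Implicit Types (s t : {perm T}) (X Y : {set T}) (sr : {perm T} * {perm T}).

Definition pstable sr Y := stable sr.1 Y && stable sr.2 Y.

(** For stable [X] this is transitivity on [X] of the group generated by the pair, phrased as
    minimality among nonempty stable sets so that no generated group has to be restricted or
    transported. *)
Definition ptransitive X sr :=
  (X != set0) && [forall Y : {set T},
    [&& Y \subset X, pstable sr Y & Y != set0] ==> (Y == X)].

Definition component sr X := pstable sr X && ptransitive X sr.

Definition pcommut sr : {perm T} := (sr.1 * sr.2 * sr.1^-1 * sr.2^-1)%g.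

(** Only cycles through points of [X] count, so a permutation supported on [X] does not contribute
    its fixed points outside [X]. *)
Definition cycles_on N X s : 'X_{1..N} :=
  [multinom #|[set O in porbit s @: X | #|O| == i.+1]| | i < N].

Lemma ptransitiveP X sr :
  reflect (X != set0 /\
           forall Y, Y \subset X -> pstable sr Y -> Y != set0 -> Y = X)
          (ptransitive X sr).
Proof.
apply: (iffP andP) => -[X0 trX]; split=> //.
  by move=> Y YX sY Y0; apply/eqP/(implyP (forallP trX Y)); rewrite YX sY.
by apply/forallP=> Y; apply/implyP=> /and3P[*]; apply/eqP/trX.
Qed.

Lemma pstableI sr X Y : pstable sr X -> pstable sr Y -> pstable sr (X :&: Y).
Proof. by move=> /andP[? ?] /andP[? ?]; rewrite /pstable !stableI. Qed.

Lemma pstableC sr X : pstable sr X -> pstable sr (~: X).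
Proof. by move=> /andP[? ?]; rewrite /pstable !stableC. Qed.

Lemma component_unique sr X Y x :
  component sr X -> component sr Y -> x \in X -> x \in Y -> X = Y.
Proof.
move=> /andP[sX /ptransitiveP[_ tX]] /andP[sY /ptransitiveP[_ tY]] xX xY.
have sXY := pstableI sX sY.
have XY0 : X :&: Y != set0 by apply/set0Pn; exists x; rewrite inE xX.
by rewrite -(tX _ (subsetIl X Y) sXY XY0) (tY _ (subsetIr X Y) sXY XY0).
Qed.

(** The component of [x] is a minimal stable set containing [x]. *)
Lemma component_exists sr x : exists2 X, component sr X & x \in X.
Proof.
pose P Y := pstable sr Y && (x \in Y).
have PT : P setT.
  by rewrite /P /pstable inE andbT; apply/andP; split; apply/stableP=> y; rewrite !inE.
have [X /minsetP[/andP[sX xX] minX] _] := minset_exists PT.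
exists X => //; apply/andP; split=> //; apply/ptransitiveP.
split=> [|Y YX sY Y0]; first by apply/set0Pn; exists x.
have [xY|xY] := boolP (x \in Y); first by apply: minX; rewrite // /P sY.
(* If the stable part [Y] misses [x], then [X] minus [Y] is still stable and contains [x], so
   minimality forces [Y] to be empty. *)
have XY : X :&: ~: Y = X.
  by apply: minX; rewrite ?subsetIl // /P !inE xX xY pstableI ?pstableC.
case/set0Pn: Y0 => y yY; have := subsetP YX y yY.
by rewrite -XY !inE yY andbF.
Qed.

Lemma sum_card_component sr : \sum_(X | component sr X) #|X| = #|T|.
Proof.
under eq_bigr do rewrite -sum1_card.
rewrite (exchange_big_dep predT) //= -sum1_card; apply: eq_bigr => x _.
have [X cX xX] := component_exists sr x.
rewrite (big_pred1 X) // => Y /=; apply/andP/eqP=> [[cY xY]|-> //].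
exact: (component_unique cY cX xY xX).
Qed.

Lemma perm_on_stable X s : perm_on X s -> stable s X.
Proof. by move=> sX; apply/stableP=> x; apply: perm_closed. Qed.

Lemma perm_onC_stable X s : perm_on (~: X) s -> stable s X.
Proof. by move=> sX; rewrite -(setCK X); apply/stableC/perm_on_stable. Qed.

Lemma restr_perm_stable X s x : stable s X -> x \in X -> restr_perm X s x = s x.
Proof. by rewrite stable_astabs => sX; apply: restr_permE. Qed.

Lemma restr_perm_out X s x : x \notin X -> restr_perm X s x = x.
Proof. exact: out_perm (restr_perm_on X s). Qed.

Lemma restr_permMl X s t :
  perm_on X s -> perm_on (~: X) t -> restr_perm X (s * t)%g = s.
Proof.
move=> sX tX; have stX := stableM (perm_on_stable sX) (perm_onC_stable tX).
apply/permP=> x; have [xX|xX] := boolP (x \in X); last first.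
  by rewrite restr_perm_out // (out_perm sX).
rewrite restr_perm_stable // permM (out_perm tX) // inE negbK.
by rewrite perm_closed.
Qed.

Lemma restr_permMr X s t :
  perm_on X s -> perm_on (~: X) t -> restr_perm (~: X) (s * t)%g = t.
Proof.
move=> sX tX; have stX := stableM (perm_on_stable sX) (perm_onC_stable tX).
apply/permP=> x; have [xX|xX] := boolP (x \in ~: X); last first.
  by rewrite restr_perm_out // (out_perm tX).
by rewrite restr_perm_stable ?stableC // permM (out_perm sX) // -in_setC.
Qed.

Lemma restr_permK X s :
  stable s X -> (restr_perm X s * restr_perm (~: X) s)%g = s.
Proof.
move=> sX; apply/permP=> x; rewrite permM.
have [xX|xX] := boolP (x \in X).
  rewrite (restr_perm_stable sX) // restr_perm_out // inE negbK.
  by rewrite (stableP _ _ sX).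
rewrite (@restr_perm_out X) // restr_perm_stable ?inE //.
exact: stableC.
Qed.

Lemma stable_restr_perm X Y s :
  Y \subset X -> stable s X -> stable (restr_perm X s) Y = stable s Y.
Proof.
move=> YX sX; apply: eq_forallb => x.
have [xX|xX] := boolP (x \in X); first by rewrite restr_perm_stable.
rewrite restr_perm_out // eqxx.
have -> : x \in Y = false by apply: contraNF xX; apply: subsetP.
suff /negbTE-> : s x \notin Y by [].
by apply: contraNN xX => /(subsetP YX); rewrite (stableP _ _ sX).
Qed.

Lemma ptransitive_restr_perm X sr : pstable sr X ->
  ptransitive X (restr_perm X sr.1, restr_perm X sr.2) = ptransitive X sr.
Proof.
move=> /andP[sX rX]; congr (_ && _); apply: eq_forallb => Y.
by case YX: (Y \subset X); rewrite //= /pstable !stable_restr_perm.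
Qed.

(** Restriction to [X] is a group morphism on the stabilizer of [X]. *)
Lemma pcommut_restr_perm X sr : pstable sr X ->
  pcommut (restr_perm X sr.1, restr_perm X sr.2) = restr_perm X (pcommut sr).
Proof.
rewrite /pstable !stable_astabs => /andP[sX rX].
by rewrite /pcommut /= !morphM ?morphV ?groupM ?groupV.
Qed.

Lemma stable_pcommut X sr : pstable sr X -> stable (pcommut sr) X.
Proof.
by move=> /andP[? ?]; rewrite /pcommut; do !apply: stableM => //; apply: stableV.
Qed.

Lemma eq_porbit_in X s t :
  stable s X -> {in X, s =1 t} -> {in X, porbit s =1 porbit t}.
Proof.
move=> /stableP sX st x xX.
have stI i : ((s ^+ i)%g x \in X) && ((s ^+ i)%g x == (t ^+ i)%g x).
  elim: i => [|i /andP[iX /eqP IHi]]; first by rewrite !expg0 perm1 xX /=.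
  by rewrite !expgSr !permM sX iX -IHi st /=.
apply/setP=> y; apply/porbitP/porbitP=> -[i ->]; exists i;
  by have /andP[_ /eqP->] := stI i.
Qed.

Lemma cycles_on_restr_perm N X s :
  stable s X -> cycles_on N X (restr_perm X s) = cycles_on N X s.
Proof.
move=> sX; apply/mnmP=> i; rewrite !mnmE.
suff -> : porbit (restr_perm X s) @: X = porbit s @: X by [].
apply: eq_in_imset => x xX; apply/esym/(eq_porbit_in sX) => // y yX.
by rewrite restr_perm_stable.
Qed.

Lemma stable_porbit X s x : stable s X -> x \in X -> porbit s x \subset X.
Proof.
move=> /stableP sX xX; apply/subsetP=> _ /porbitP[i ->].
by elim: i => [|i IHi]; rewrite ?perm1 // expgSr permM sX.
Qed.

Lemma cycles_onT N X s : stable s X ->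
  cycles_on N [set: T] s = (cycles_on N X s + cycles_on N (~: X) s)%MM.
Proof.
move=> sX; apply/mnmP=> i; rewrite mnmDE !mnmE -(setUCr X) imsetU.
rewrite setIdE setIUl -!setIdE cardsU -[RHS]subn0; congr (_ - _).
(* No cycle is counted twice: one meeting the complement of [X], which is stable, lies inside it. *)
apply/eqP; rewrite cards_eq0; apply/set0Pn=> -[O].
rewrite !inE => /andP[/andP[/imsetP[x xX ->] _] /andP[/imsetP[y yX]]] Oxy _.
have := subsetP (stable_porbit (stableC sX) yX) x.
by rewrite -Oxy porbit_id inE xX => /(_ isT).
Qed.

Definition pair_on X sr := perm_on X sr.1 && perm_on X sr.2.

Lemma pair_onT sr : pair_on [set: T] sr.
Proof. by apply/andP; split; apply/subsetP=> x; rewrite inE. Qed.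

Definition pair_sum N X : {mpoly rat[N]} :=
  (\sum_(sr | pair_on X sr) 'X_[cycles_on N X (pcommut sr)])%R.

Definition trans_sum N X : {mpoly rat[N]} :=
  (\sum_(sr | pair_on X sr && ptransitive X sr)
     'X_[cycles_on N X (pcommut sr)])%R.

(** A pair with component [X] is the same as a transitive pair on [X] together with an arbitrary
    pair on the complement: [h'] restricts, [h] multiplies back. The weight is multiplicative
    because the cycles of the commutator split accordingly. *)
Lemma component_split N X :
  (\sum_(sr | component sr X) 'X_[cycles_on N [set: T] (pcommut sr)] =
   trans_sum N X * pair_sum N (~: X))%R.
Proof.
rewrite /trans_sum /pair_sum big_distrlr /= pair_big /=.
pose h (p : ({perm T} * {perm T}) * ({perm T} * {perm T})) :=
  ((p.1.1 * p.2.1)%g, (p.1.2 * p.2.2)%g).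
pose h' (sr : {perm T} * {perm T}) :=
  ((restr_perm X sr.1, restr_perm X sr.2),
   (restr_perm (~: X) sr.1, restr_perm (~: X) sr.2)).
rewrite (reindex_onto h' h) /=; last first.
  case=> -[s1 r1] [s2 r2] /= /andP[/andP[/andP[/= s1X r1X] _] /andP[/= s2X r2X]].
  by rewrite /h' /h /= !(@restr_permMr X) ?(@restr_permMl X).
apply: eq_big => [sr | sr /andP[sX _]].
  rewrite /pair_on /= !restr_perm_on /= andbT.
  apply/andP/andP=> [[sX tX]|[tX /eqP hh]].
    rewrite ptransitive_restr_perm // tX; split=> //.
    by case/andP: sX => sX rX; rewrite /h /= !restr_permK //; case: (sr).
  (* The round trip [h (h' sr) = sr] encodes stability of [X], since a product of permutations
     supported on [X] and on its complement preserves [X]. *)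
  have sX : pstable sr X.
    rewrite -hh /pstable /=; apply/andP.
    by split; apply: stableM;
      rewrite ?(perm_on_stable (restr_perm_on _ _)) //
              (perm_onC_stable (restr_perm_on _ _)).
  by rewrite ptransitive_restr_perm in tX.
have sX' := stable_pcommut sX.
rewrite (cycles_onT N sX') mpolyXD; congr ('X_[_] * 'X_[_])%R.
  by rewrite (pcommut_restr_perm sX) cycles_on_restr_perm.
by rewrite (pcommut_restr_perm (pstableC sX)) cycles_on_restr_perm // stableC.
Qed.

(** Each pair is weighted by [#|T|], the sum of the sizes of its components; exchanging the sums
    makes the component [X] the outer index. This is the source of F' = C' F. *)
Lemma pair_sum_rec N :
  (pair_sum N [set: T] *+ #|T| =
   \sum_(X : {set T}) (trans_sum N X * pair_sum N (~: X)) *+ #|X|)%R.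
Proof.
under eq_bigr do rewrite -component_split -sumrMnl.
rewrite (exchange_big_dep predT) //= /pair_sum -sumrMnl.
apply: eq_big => [sr | sr _]; first by rewrite pair_onT.
by rewrite -(sum_card_component sr) -sumrMnr; apply: eq_bigl.
Qed.

End Components.

(** * Invariance under injections *)

Section Transfer.
Variables (T1 T2 : finType) (f : T1 -> T2).
Hypothesis f_inj : injective f.
Implicit Types (s t : {perm T1}) (Y Z : {set T1}) (sr : {perm T1} * {perm T1}).
Local Notation im := (f @: [set: T1]).

Definition extend_fun (s : {perm T1}) y :=
  if [pick x | f x == y] is Some x then f (s x) else y.

Lemma extend_fun_im s x : extend_fun s (f x) = f (s x).
Proof.
by rewrite /extend_fun; case: pickP => [z /eqP/f_inj-> // | /(_ x)]; rewrite eqxx.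
Qed.

Lemma extend_fun_out s y : y \notin im -> extend_fun s y = y.
Proof.
move=> yf; rewrite /extend_fun; case: pickP => // x /eqP fx.
by rewrite -fx imset_f in yf.
Qed.

Lemma extend_fun_inj s : injective (extend_fun s).
Proof.
have imP y : (y \in im) = (extend_fun s y \in im).
  have [/imsetP[x _ ->]|yf] := boolP (y \in im).
    by rewrite extend_fun_im imset_f.
  by rewrite extend_fun_out // (negbTE yf).
move=> y z eyz; have := imP y; rewrite {1}eyz -imP.
have [/imsetP[x _ yx]|yf] := boolP (y \in im).
  move=> /esym/imsetP[x' _ zx]; move: eyz; rewrite yx zx !extend_fun_im.
  by move=> /f_inj/perm_inj->.
by move=> /esym/negbT zf; rewrite !extend_fun_out in eyz.
Qed.

Definition extend s : {perm T2} := perm (@extend_fun_inj s).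

Lemma extendE s x : extend s (f x) = f (s x).
Proof. by rewrite permE extend_fun_im. Qed.

Lemma extend_on s : perm_on im (extend s).
Proof.
apply/subsetP=> y; rewrite inE; apply: contraNT => yf.
by rewrite permE extend_fun_out.
Qed.

Lemma extendM s t : extend (s * t)%g = (extend s * extend t)%g.
Proof.
apply/permP=> y; rewrite permM.
have [/imsetP[x _ ->]|yf] := boolP (y \in im); first by rewrite !extendE permM.
by rewrite !(out_perm (extend_on _) yf).
Qed.

Lemma extendV s : extend s^-1%g = (extend s)^-1%g.
Proof.
have ext1 : extend 1%g = 1%g by apply: (mulIg (extend 1)); rewrite -extendM !mul1g.
by apply: (mulIg (extend s)); rewrite -extendM !mulVg.
Qed.

Lemma extend_inj : injective extend.
Proof.
move=> s t est; apply/permP=> x; apply: f_inj.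
by rewrite -!extendE est.
Qed.

Lemma extend_surj (u : {perm T2}) : perm_on im u -> exists s, u = extend s.
Proof.
move=> uf; have fu x : exists z, f z == u (f x).
  have : u (f x) \in im by rewrite perm_closed // imset_f.
  by case/imsetP=> z _ ->; exists z.
pose v x := xchoose (fu x).
have fv x : f (v x) = u (f x) by apply/eqP/(xchooseP (fu x)).
have v_inj : injective v.
  by move=> x y /(congr1 f); rewrite !fv => /perm_inj/f_inj.
exists (perm v_inj); apply/permP=> y.
have [/imsetP[x _ ->]|yf] := boolP (y \in im); first by rewrite extendE permE fv.
by rewrite (out_perm uf yf) (out_perm (extend_on _) yf).
Qed.

Definition extend_pair sr := (extend sr.1, extend sr.2).

Lemma pcommut_extend sr : pcommut (extend_pair sr) = extend (pcommut sr).
Proof. by rewrite /pcommut /= !extendM !extendV. Qed.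

Lemma porbit_extend s x : porbit (extend s) (f x) = f @: porbit s x.
Proof.
have extX i : ((extend s) ^+ i)%g (f x) = f ((s ^+ i)%g x).
  by elim: i => [|i IHi]; rewrite ?perm1 // !expgSr !permM IHi extendE.
apply/setP=> y; apply/porbitP/imsetP=> [[i ->]|[z /porbitP[i ->] ->]].
  by exists ((s ^+ i)%g x); rewrite ?extX // mem_porbit.
by exists i; rewrite extX.
Qed.

Lemma cycles_on_extend N s : cycles_on N im (extend s) = cycles_on N [set: T1] s.
Proof.
apply/mnmP=> i; rewrite !mnmE -(card_imset _ (imset_inj f_inj)).
congr #|pred_of_set _|; apply/setP=> O.
apply/setIdP/imsetP=> [[/imsetP[_ /imsetP[x _ ->] ->]]|[O' /setIdP[/imsetP[x _ ->] cO] ->]].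
  rewrite porbit_extend card_imset // => cO.
  by exists (porbit s x) => //; rewrite inE imset_f.
by rewrite card_imset // cO -porbit_extend imset_f // imset_f.
Qed.

Lemma stable_extend s Z : stable (extend s) (f @: Z) = stable s Z.
Proof.
apply/stableP/stableP=> sZ x; first by have := sZ (f x); rewrite extendE !mem_imset.
have [/imsetP[z _ ->]|yf] := boolP (x \in im).
  by rewrite extendE !mem_imset.
by rewrite (out_perm (extend_on _) yf).
Qed.

Lemma ptransitive_extend sr :
  ptransitive im (extend_pair sr) = ptransitive [set: T1] sr.
Proof.
have st0 Z : (f @: Z != set0) = (Z != set0).
  by rewrite -!card_gt0 card_imset.
have stE Z : pstable (extend_pair sr) (f @: Z) = pstable sr Z.
  by rewrite /pstable /= !stable_extend.
apply/ptransitiveP/ptransitiveP; rewrite st0 => -[T0 tr]; split=> // Y YX sY Y0.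
  by apply: (imset_inj f_inj) => /=; apply: tr; rewrite ?imsetS ?stE ?st0.
have eY : f @: (f @^-1: Y) = Y.
  apply/setP=> y; apply/imsetP/idP=> [[x]|yY]; first by rewrite inE => ? ->.
  by have /imsetP[x _ yx] := subsetP YX y yY; exists x; rewrite ?inE -?yx.
rewrite -eY; suff -> : f @^-1: Y = setT by [].
by apply: tr; rewrite ?subsetT -?stE -?st0 ?eY.
Qed.

(** Transport along [f], with the identity outside the image, is a bijection onto the pairs
    supported on the image and preserves the cycle type of the commutator. *)
Lemma sum_extend N (P2 : pred ({perm T2} * {perm T2}))
    (P1 : pred ({perm T1} * {perm T1})) :
  (forall sr, P2 (extend_pair sr) = P1 sr) ->
  (\sum_(sr | pair_on im sr && P2 sr) 'X_[cycles_on N im (pcommut sr)] =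
   \sum_(sr | P1 sr) 'X_[cycles_on N [set: T1] (pcommut sr)] :> {mpoly rat[N]})%R.
Proof.
move=> P12; pose A := [set sr | P1 sr].
transitivity (\sum_(sr in extend_pair @: A)
    'X_[cycles_on N im (pcommut sr)] : {mpoly rat[N]})%R.
  apply: eq_bigl => -[s r]; apply/andP/imsetP=> [[/andP[/= sf rf] P2sr]|].
    have [s' es] := extend_surj sf; have [r' er] := extend_surj rf.
    by exists (s', r'); rewrite ?inE /extend_pair /= -?P12 /extend_pair /= -?es -?er.
  by case=> sr; rewrite inE => P1sr ->; rewrite P12 /pair_on !extend_on.
rewrite big_imset /=; last first.
  by move=> [s r] [s' r'] _ _ /= [/extend_inj-> /extend_inj->].
apply: eq_big => [sr|sr _]; first by rewrite inE.
by rewrite pcommut_extend cycles_on_extend.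
Qed.

Lemma pair_sum_extend N : pair_sum N im = pair_sum N [set: T1].
Proof.
rewrite /pair_sum -[RHS](@sum_extend N predT) => [|sr]; last by rewrite pair_onT.
by apply: eq_bigl => sr; rewrite andbT.
Qed.

Lemma trans_sum_extend N : trans_sum N im = trans_sum N [set: T1].
Proof. by apply: sum_extend => sr; rewrite pair_onT ptransitive_extend. Qed.

End Transfer.

(** * Weighted counts by degree and their binomial recurrence *)

Definition pair_gf N k : {mpoly rat[N]} := pair_sum N [set: 'I_k].
Definition trans_gf N k : {mpoly rat[N]} := trans_sum N [set: 'I_k].

Lemma im_enum_val (T : finType) (X : {set T}) :
  (@enum_val T (mem X)) @: [set: 'I_#|X|] = X.
Proof.
apply/setP=> x; apply/imsetP/idP=> [[i _ ->]|xX]; first exact: enum_valP.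
by exists (enum_rank_in xX x); rewrite ?inE ?enum_rankK_in.
Qed.

Lemma pair_sumE N (T : finType) (X : {set T}) : pair_sum N X = pair_gf N #|X|.
Proof. by rewrite -[in LHS](im_enum_val X) (pair_sum_extend (@enum_val_inj _ _)). Qed.

Lemma trans_sumE N (T : finType) (X : {set T}) : trans_sum N X = trans_gf N #|X|.
Proof. by rewrite -[in LHS](im_enum_val X) (trans_sum_extend (@enum_val_inj _ _)). Qed.

(** Both sums depend only on the size of the set, so the subsets are grouped by cardinality, with
    ['C(k, j)] of size [j]. *)
Lemma pair_gf_rec N k :
  (pair_gf N k *+ k =
   \sum_(j < k.+1) (trans_gf N j * pair_gf N (k - j)) *+ ('C(k, j) * j))%R.
Proof.
have := pair_sum_rec 'I_k N; rewrite card_ord /pair_gf => ->.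
pose sz (X : {set 'I_k}) : 'I_k.+1 := inord #|X|.
have szE X : sz X = #|X| :> nat.
  by rewrite inordK // ltnS -[leqRHS](card_ord k) max_card.
rewrite (partition_big sz predT) //=; apply: eq_bigr => j _.
transitivity (\sum_(X in [set A : {set 'I_k} | #|A| == j])
   (trans_gf N j * pair_gf N (k - j)) *+ j)%R.
  apply: eq_big => [X|X /eqP <-]; first by rewrite inE -val_eqE /= szE.
  by rewrite szE pair_sumE trans_sumE (cardsCs (~: X)) setCK card_ord.
by rewrite sumr_const card_draws card_ord mulnC mulrnA.
Qed.

(** * The logarithm of the generating function *)

Lemma porbitsE (T : finType) (s : {perm T}) : porbits s = porbit s @: [set: T].
Proof. by apply/setP=> O; apply/imsetP/imsetP=> -[x _ ->]; exists x; rewrite ?inE. Qed.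

Lemma cyctypeE N k (s : 'S_k) : cyctype N s = cycles_on N [set: 'I_k] s.
Proof. by apply/mnmP=> i; rewrite !mnmE porbitsE. Qed.

(** The weight 1 gives the number of cycles and the weight [id] gives [k]. The bound [k <= N]
    ensures that every cycle length has a variable. *)
Lemma sum_cyctype N k (s : 'S_k) (w : nat -> nat) : k <= N ->
  \sum_(i < N) w i.+1 * cyctype N s i = \sum_(O in porbits s) w #|O|.
Proof.
move=> kN.
have cO O : O \in porbits s -> 0 < #|O| <= N.
  case/imsetP=> x _ ->; rewrite lt0n card_porbit_neq0 /=.
  by apply: leq_trans kN; rewrite -[leqRHS](card_ord k) max_card.
transitivity (\sum_(i < N) \sum_(O in [set O in porbits s | #|O| == i.+1]) w i.+1).
  by apply: eq_bigr => i _; rewrite sum_nat_const mulnC mnmE.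
rewrite (exchange_big_dep (mem (porbits s))) /=; last first.
  by move=> i O _; rewrite inE => /andP[].
apply: eq_bigr => O Os; case/andP: (cO O Os) => O0 ON.
have ltO : #|O|.-1 < N by rewrite prednK.
rewrite (big_pred1 (Ordinal ltO)) /= ?prednK // => i.
by rewrite !inE Os /= -val_eqE /= -[in LHS](prednK O0) eqSS eq_sym.
Qed.

Lemma mdeg_cyctype N k (s : 'S_k) : k <= N -> mdeg (cyctype N s) = #|porbits s|.
Proof.
move=> kN; rewrite mdegE -sum1_card -(sum_cyctype s (fun=> 1) kN).
by apply: eq_bigr => i _; rewrite mul1n.
Qed.

Lemma pweight_cyctype N k (s : 'S_k) : k <= N -> pweight (cyctype N s) = k.
Proof.
move=> kN; rewrite /pweight (sum_cyctype s id kN) porbitsE porbitE.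
have actT : [acts <[s]>%g, on [set: 'I_k] | 'P].
  by apply/subsetP=> a _; rewrite -stable_astabs; apply/stableP=> x; rewrite !inE.
by rewrite (acts_sum_card_orbit actT) cardsT card_ord.
Qed.

Local Open Scope ring_scope.

Section TransitiveCoefficients.
Variables (N k : nat).

Lemma pair_gfE : pair_gf N k = \sum_(sr : 'S_k * 'S_k) 'X_[cyctype N (commut sr)].
Proof. by apply: eq_big => sr; rewrite ?pair_onT ?cyctypeE. Qed.

Lemma trans_gfE : trans_gf N k =
  \sum_(sr : 'S_k * 'S_k | ptransitive setT sr) 'X_[cyctype N (commut sr)].
Proof. by apply: eq_big => sr; rewrite ?pair_onT ?cyctypeE. Qed.

Lemma mcoeff_sumX (P : pred ('S_k * 'S_k)) m :
  (\sum_(sr | P sr) 'X_[cyctype N (commut sr)] : {mpoly rat[N]})@_m =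
  #|[set sr | P sr && (cyctype N (commut sr) == m)]|%:R.
Proof.
rewrite raddf_sum /= -sum1dep_card natr_sum big_mkcondr /=.
by apply: eq_bigr => sr _; rewrite mcoeffX; case: eqP.
Qed.

(** The truncation in [Pcoef] loses nothing: the degree of a cycle type is its number of cycles, at
    most [k], and its weight is exactly [k]. *)
Lemma PcoefE : (k <= N)%N -> Pcoef N k = (k`!%:R)^-1 *: pair_gf N k.
Proof.
move=> kN; rewrite [pair_gf N k](@mpolywE _ _ k.+1); last first.
  rewrite pair_gfE (leq_trans (msize_sum _ _ _)) //; apply/bigmax_leqP => sr _.
  rewrite msizeX ltnS mdeg_cyctype // /porbits.
  by rewrite (leq_trans (leq_imset_card _ _)) // cardT size_enum_ord.
rewrite scaler_sumr /Pcoef big_mkcond; apply: eq_bigr => m _ /=.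
rewrite scalerA pair_gfE mcoeff_sumX /= /hcirc mulrC; case: eqP => // wm.
have -> : [set sr : 'S_k * 'S_k | cyctype N (commut sr) == m] = set0.
  apply/setP=> sr; rewrite !inE; apply/eqP=> em; apply: wm.
  by rewrite -em pweight_cyctype.
by rewrite cards0 mulr0 scale0r.
Qed.

End TransitiveCoefficients.

Lemma pair_gf0 N : pair_gf N 0 = 1.
Proof.
rewrite pair_gfE (big_pred1 (1%g, 1%g)) => [|[s r]]; last first.
  have one (u : 'S_0) : u = 1%g by apply/permP=> -[].
  by rewrite /= (one s) (one r) eqxx.
rewrite -mpolyX0; congr 'X_[_]; apply/mnmP=> i; rewrite mnmE mnm0E.
apply/eqP; rewrite cards_eq0; apply/eqP/setP=> O; rewrite !inE.
by apply/negbTE/negP=> /andP[/imsetP[[]]].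
Qed.

(** * Logarithms of power series modulo a power of t *)

Section Logarithm.
Variable R : comNzRingType.
Implicit Types p q F C : {poly R}.

Lemma poly_vanish_ltn (n : nat) p :
  (forall i, (i < n)%N -> p`_i = 0) -> exists u, p = u * 'X^n.
Proof.
move=> p0; exists (drop_poly n p); rewrite -[LHS](poly_take_drop n) -[RHS]add0r.
congr (_ + _); apply/polyP=> i; rewrite coef_take_poly coef0.
by case: ltnP => // /p0.
Qed.

(** Modulo t^n, the truncated logarithm has derivative F'/F, which is C'. As [R] need not allow
    division, [q j] stands for (-1)^j/(j+1) through its defining equation, and the conclusion keeps
    the factor [i.+1]. *)
Lemma log_coef F C (q : nat -> R) (n : nat) :
    F`_0 = 1 -> (forall j, q j *+ j.+1 = (-1) ^+ j) ->
    (forall i, (i < n)%N -> F^`()`_i = (C^`() * F)`_i) ->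
  forall i, (i < n)%N ->
    (\sum_(j < n) (q j)%:P * (F - 1) ^+ j.+1)`_i.+1 *+ i.+1 = C`_i.+1 *+ i.+1.
Proof.
move=> F0 qE FC i ltin; set L := \sum_(j < n) _.
rewrite -!coef_deriv; apply/eqP; rewrite -subr_eq0 -coefB.
(* The geometric sum [S] inverts [F] modulo t^n, because [1 - F] has no constant term. *)
pose S := \sum_(j < n) (1 - F) ^+ j.
have dL : L^`() = F^`() * S.
  rewrite /L raddf_sum mulr_sumr; apply: eq_bigr => j _.
  rewrite /= deriv_mulC deriv_exp derivB derivC subr0 /= -mulrnAr mulrCA.
  congr (_ * _); rewrite mulrnAr -mulrnAl -polyCMn qE -[1 - F]opprB.
  by rewrite [in RHS]exprNn polyC_exp polyCN.
have [v vE] : exists v, F - 1 = v * 'X^1.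
  by apply: poly_vanish_ltn => -[] // _; rewrite coefB coef1 F0 subrr.
have [u uE] : exists u, F^`() - C^`() * F = u * 'X^n.
  by apply: poly_vanish_ltn => j ltjn; rewrite coefB FC ?subrr.
have FS : F * S = 1 - (1 - F) ^+ n.
  by rewrite -[RHS]opprB subrX1 -mulNr; congr (_ * _); rewrite addrAC subrr add0r opprK.
have Xn : (1 - F) ^+ n = (- v) ^+ n * 'X^n.
  by rewrite -exprMn_comm ?mulNr -?[1 - F]opprB ?vE //; apply: mulrC.
(* Substitute F' = C' F + u t^n into L' = F' S, then use F S = 1 - (-v)^n t^n. *)
have -> : L^`() - C^`() = (u * S - C^`() * (- v) ^+ n) * 'X^n.
  rewrite dL -[F^`()](subrK (C^`() * F)) uE mulrDl -[_ * F * S]mulrA FS Xn.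
  by rewrite mulrBr mulr1 mulrBl -addrA addrAC subrr add0r mulrA mulrAC.
by rewrite coefMXn ltin.
Qed.

End Logarithm.

(** * The logarithm counts transitive pairs *)

Section ConnectedCoefficients.
Variable n : nat.

Definition connected_ser : {poly {mpoly rat[n]}} :=
  \poly_(k < n.+1) ((k`!%:R)^-1 *: trans_gf n k).

Lemma FserE : Fser n n = \poly_(k < n.+1) ((k`!%:R)^-1 *: pair_gf n k).
Proof.
rewrite poly_def; apply: eq_bigr => k _.
by rewrite mul_polyC PcoefE // -ltnS.
Qed.

Lemma deriv_Fser i : (i < n)%N ->
  (Fser n n)^`()`_i = (connected_ser^`() * Fser n n)`_i.
Proof.
move=> ltin; rewrite coef_deriv coefM FserE coef_poly ltnS ltin.
(* The term of size 0 vanishes through its factor [j]; the shift to [j.+1] matches the coefficients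
   of C'. *)
rewrite scalerMnr pair_gf_rec scaler_sumr big_ord_recl /= muln0 mulr0n scaler0.
rewrite add0r; apply: eq_bigr => -[j /= ltji] _.
rewrite coef_deriv !coef_poly /bump /= add1n subSS.
have -> : (j.+1 < n.+1)%N by rewrite ltnS (leq_trans _ ltin).
have -> : (i - j < n.+1)%N by rewrite ltnS (leq_trans (leq_subr _ _)) // ltnW.
rewrite mulrnAl -scalerAl -scalerAr scalerA -scalerMnr.
rewrite [_ *+ ('C(_, _) * _)]mulrnA; congr (_ *+ j.+1).
rewrite -[_ *+ 'C(_, _)]scaler_nat scalerA; congr (_ *: _).
(* The binomial coefficient over (i+1)! is 1/((j+1)! (i-j)!), the exponential normalization of the
   two factors. *)
have := bin_fact ltji; rewrite subSS => <-.
have nzb : ('C(i.+1, j.+1)%:R : rat) != 0.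
  by rewrite Num.Theory.pnatr_eq0 -lt0n bin_gt0.
by rewrite (natrM _ 'C(_, _)) invfM mulrA mulfV // mul1r (natrM _ j.+1`!) invfM.
Qed.

Lemma hcoefE (m : 'X_{1..n}) : (0 < n)%N ->
  hcoef m = (n`!%:R)^-1 * (trans_gf n n)@_m.
Proof.
move=> n0; rewrite /hcoef -mcoeffZ; congr (_@_m).
have F0 : (Fser n n)`_0 = 1 by rewrite FserE coef_poly /= pair_gf0 invr1 scale1r.
have qE j : ((((-1) ^+ j / j.+1%:R : rat)%:MP : {mpoly rat[n]})) *+ j.+1 = (-1) ^+ j.
  rewrite -mpolyCMn -[_ / _ *+ _]mulr_natr divfK ?Num.Theory.pnatr_eq0 //.
  by rewrite rmorphXn rmorphN1.
have := log_coef F0 qE deriv_Fser; rewrite -/(Lser n n).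
move/(_ n.-1); rewrite prednK // => /(_ (leqnn _)) eL.
(* Over the rationals the factor [n], nonzero by [n0], can be cancelled. *)
have /eqP : (Lser n n)`_n *+ n - connected_ser`_n *+ n = 0 by rewrite eL subrr.
rewrite -mulrnBl -scaler_nat scaler_eq0 Num.Theory.pnatr_eq0 gtn_eqF //=.
by rewrite subr_eq0 coef_poly leqnn => /eqP.
Qed.

End ConnectedCoefficients.

(** * Comparison of the two counts *)

(** After exchanging the sums, each transitive pair contributes only to the monomial of its
    commutator's cycle type, whose degree is the number of cycles. *)
Lemma HorigE (g n : nat) : (0 < n)%N ->
  Horig g n = #|[set sr : 'S_n * 'S_n | ptransitive setT sr
                 && (#|porbits (commut sr)| + 2 * g == n + 2)%N]|%:R / n`!%:R.
Proof.
move=> n0; rewrite /Horig; under eq_bigr do rewrite hcoefE //.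
rewrite -mulr_sumr mulrC.
congr (_ / _); under eq_bigr do rewrite trans_gfE mcoeff_sumX -sum1dep_card natr_sum.
rewrite -sum1dep_card natr_sum.
rewrite (exchange_big_dep (fun sr : 'S_n * 'S_n => ptransitive setT sr
  && (#|porbits (commut sr)| + 2 * g == n + 2)%N)) /=; last first.
  move=> m sr /andP[_ dm] /andP[-> /eqP em].
  by rewrite -(mdeg_cyctype (commut sr) (leqnn n)) em.
apply: eq_bigr => sr /andP[tsr csr].
have ltm : (mdeg (cyctype n (commut sr)) < n.+1)%N.
  rewrite ltnS mdeg_cyctype // /porbits.
  by rewrite (leq_trans (leq_imset_card _ _)) // cardT size_enum_ord.
rewrite (big_pred1 (BMultinom ltm)) // => m /=.
rewrite tsr; apply/andP/eqP=> [[_ /eqP em]|->]; first exact: val_inj.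
by rewrite pweight_cyctype // mdeg_cyctype // csr !eqxx.
Qed.

(** The product of [ts] is the inverse commutator, so a set stable under [s] and [r] is stable under
    that product, hence under each transposition. *)
Lemma transitive_monotoneE n (s r : 'S_n) (ts : seq 'S_n) : (0 < n)%N ->
    strictly_monotone ts -> (commut (s, r) * \prod_(t <- ts) t)%g = 1%g ->
  [transitive <<([set s; r] :|: [set t in ts])>>%g, on [set: 'I_n] | 'P]%g =
  ptransitive setT (s, r).
Proof.
move=> n0 smts prod1; have cardn : (0 < #|'I_n|)%N by rewrite card_ord.
apply/transitive_stableP/ptransitiveP=> // [tr|[_ tr] Y stY Y0]; last first.
  apply: tr => //; apply/andP.
  by split; apply: stY; rewrite !inE eqxx ?orbT.
split=> [|Y _ /andP[/= sY rY] Y0]; first by rewrite -card_gt0 cardsT.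
apply: tr => // t; rewrite !inE => /orP[/pred2P[]-> //|tts].
apply: (strictly_monotone_stable smts) tts.
have -> : (\prod_(t <- ts) t = (commut (s, r))^-1)%g.
  by apply: (mulgI (commut (s, r))); rewrite prod1 mulgV.
by apply/stableV/stable_pcommut/andP.
Qed.

(** Forgetting the transpositions is injective by uniqueness of the factorization. By existence, its
    image is cut out by transitivity and the cycle count, which fixes the number of factors. *)
Lemma HmonoE (g n : nat) : (0 < g)%N -> (0 < n)%N ->
  Hmono g n = #|[set sr : 'S_n * 'S_n | ptransitive setT sr
                 && (#|porbits (commut sr)| + 2 * g == n + 2)%N]|%:R / n`!%:R.
Proof.
move=> g0 n0; rewrite /Hmono; congr (_%:R / _).
have inj : {in monotone_tuples g n &, injective (fun x => x.1)}.
  move=> [[s r] ts] [[s' r'] ts']; rewrite !inE /=.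
  move=> /and3P[smts /eqP pts _] /and3P[smts' /eqP pts' _] [es er].
  rewrite -es -er in pts'; rewrite es er; congr (_, _); apply/val_inj => /=.
  by apply: strictly_monotone_inj => //; apply: (mulgI (commut (s, r)));
    rewrite [LHS]pts [RHS]pts'.
rewrite -(card_in_imset inj); congr #|pred_of_set _|; apply/setP=> -[s r].
have cardE ts : strictly_monotone ts ->
    (commut (s, r) * \prod_(t <- ts) t)%g = 1%g ->
    (#|porbits (commut (s, r))| + size ts = n)%N.
  move=> smts prod1; rewrite -[RHS](card_porbits_strictly_monotone smts).
  congr (#|pred_of_set _| + _)%N; rewrite -porbitsV; congr porbits.
  by apply: (mulgI (commut (s, r))); rewrite prod1 mulgV.
(* The natural-number subtraction [2 * g - 2] is exact because [g] is positive. *)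
have sizeE (c : nat) : (c + 2 * g == n + 2)%N = (c + (2 * g - 2) == n)%N.
  have g2 : (2 <= 2 * g)%N by rewrite -[leqLHS]muln1 leq_mul2l.
  by rewrite -[in LHS](subnK g2) addnA eqn_add2r.
apply/imsetP/idP=> [[[[s' r'] ts]]|].
  rewrite !inE => /and3P[smts /eqP prod1 trts] /= [es er]; subst s' r'.
  rewrite -(transitive_monotoneE n0 smts prod1) trts sizeE.
  by have := cardE _ smts prod1; rewrite size_tuple => /eqP.
rewrite inE => /andP[tsr]; rewrite sizeE => /eqP csr.
have [ts smts prodE] := strictly_monotone_exists (commut (s, r))^-1%g.
have prod1 : (commut (s, r) * \prod_(t <- ts) t)%g = 1%g by rewrite prodE mulgV.
have sz : size ts == (2 * g - 2)%N.
  by rewrite -(eqn_add2l #|porbits (commut (s, r))|) csr (cardE _ smts prod1).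
exists (s, r, Tuple sz) => //; rewrite inE smts /= (transitive_monotoneE n0 smts prod1).
by rewrite tsr andbT; apply/eqP.
Qed.

Theorem mainTheorem7 (g n : nat) : (1 <= g)%N -> (1 <= n)%N -> Hmono g n = Horig g n.
Proof. by move=> g0 n0; rewrite HmonoE // HorigE. Qed.
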